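(* Let $I$ be a non-empty set and let $\mathbb{X}_i=\langle X_i,\rho_i\rangle$, $i\in I$, be pairwise disjoint non-empty tournaments such that the sequence of cardinals $\langle |X_i| : i\in I\rangle$ is reversible. Then the digraph $\bigcup_{i\in I}\mathbb{X}_i=\langle\bigcup_{i\in I}X_i,\bigcup_{i\in I}\rho_i\rangle$ is reversible. In particular, if $\mathbb{X}_i$, $i\in I$, are pairwise disjoint non-empty linear orders such that $\langle |X_i| : i\in I\rangle$ is reversible, then $\bigcup_{i\in I}\mathbb{X}_i$ is a reversible (disconnected, if $|I|>1$) partial order.
   Context: A tournament is a binary structure $\langle X,\rho\rangle$ with $\rho$ irreflexive and such that for all distinct $x,y\in X$ exactly one of $\langle x,y\rangle\in\rho$, $\langle y,x\rangle\in\rho$ holds. A binary structure $\mathbb{X}=\langle X,\rho\rangle$ is reversible iff every bijection $f:X\to X$ with $\langle x,y\rangle\in\rho\Rightarrow\langle f(x),f(y)\rangle\in\rho$ is an automorphism. A sequence of non-zero cardinals $\langle\kappa_i:i\in I\rangle$ is reversible iff there is no non-injective surjection $f:I\to I$ such that $\kappa_j=\sum_{i\in f^{-1}[\{j\}]}\kappa_i$ for all $j\in I$. *)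

(* Defs.v *)
From Stdlib Require Import Relation_Operators.
From mathcomp Require Import all_boot.
From mathcomp Require Import boolp classical_sets functions cardinality.

Set Implicit Arguments.
Unset Strict Implicit.
Unset Printing Implicit Defensive.

Local Open Scope classical_set_scope.

Record binary_structure (T : Type) := BinaryStructure {
  carrier : set T;
  edge : set (T * T);
  edge_sub : edge `<=` carrier `*` carrier }.

Section BinaryStructures.
Context {T : Type}.
Implicit Types X : binary_structure T.

Definition irreflexive_structure X : Prop := forall x, ~ edge X (x, x).

Definition transitive_structure X : Prop :=
  forall x y z, edge X (x, y) -> edge X (y, z) -> edge X (x, z).

Definition tournament X : Prop :=
  irreflexive_structure X /\
  forall x y, carrier X x -> carrier X y -> x <> y ->
    (edge X (x, y) /\ ~ edge X (y, x)) \/ (edge X (y, x) /\ ~ edge X (x, y)).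

(* Orders are strict, so that linear orders are tournaments. *)
Definition partial_order X : Prop :=
  irreflexive_structure X /\ transitive_structure X.

Definition linear_order X : Prop :=
  partial_order X /\
  forall x y, carrier X x -> carrier X y -> x <> y ->
    edge X (x, y) \/ edge X (y, x).

(* Self-maps of the carrier are maps of the ambient type T, of which only the
   restriction to the carrier matters. *)
Definition bijective_endomorphism X (f : T -> T) : Prop :=
  set_bij (carrier X) (carrier X) f /\
  forall x y, edge X (x, y) -> edge X (f x, f y).

Definition automorphism X (f : T -> T) : Prop :=
  set_bij (carrier X) (carrier X) f /\
  forall x y, carrier X x -> carrier X y ->
    (edge X (x, y) <-> edge X (f x, f y)).

Definition reversible X : Prop :=
  forall f : T -> T, bijective_endomorphism X f -> automorphism X f.

(* Any two points are joined by a finite path that ignores the orientation of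
   the edges; such a path stays in the carrier by [edge_sub]. *)
Definition connected_structure X : Prop :=
  forall x y, carrier X x -> carrier X y ->
    clos_refl_sym_trans T (fun a b => edge X (a, b)) x y.

Definition disconnected_structure X : Prop := ~ connected_structure X.

End BinaryStructures.

Lemma union_edge_sub (T I : Type) (X : I -> binary_structure T) :
  \bigcup_i edge (X i) `<=`
    (\bigcup_i carrier (X i)) `*` (\bigcup_i carrier (X i)).
Proof.
by move=> [x y] [i _ /edge_sub [/= Xx Xy]]; split; exists i.
Qed.

Definition union_structure (T I : Type) (X : I -> binary_structure T) :
  binary_structure T := BinaryStructure (@union_edge_sub T I X).

(* A family of cardinals is given by representing sets K i, equality of
   cardinals being [#=]. *)

(* The disjoint union of the K i, i in A, which represents the cardinal
   sum_(i in A) |K i|. *)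
Definition card_sum (T I : Type) (A : set I) (K : I -> set T) : set (I * T) :=
  A `*`` K.

Definition reversible_cardinals (T I : Type) (K : I -> set T) : Prop :=
  ~ exists f : I -> I,
      [/\ set_surj [set: I] [set: I] f,
          ~ set_inj [set: I] f
        & forall j, (K j #= card_sum (f @^-1` [set j]) K)%card].

(* Main.v *)
From Stdlib Require Import Relation_Operators.
Require Import Defs.
From mathcomp Require Import all_boot.
From mathcomp Require Import boolp classical_sets functions cardinality.

Local Open Scope classical_set_scope.

(** Two points of a tournament are adjacent, so a bijective endomorphism f of
    the union maps each component X_i into a single component X_(g i). As f is
    a bijection, g is onto and |X_j| is the sum of the |X_i| over g i = j;
    reversibility of the cardinals makes g injective. Then an edge between f x
    and f y forces x and y into a common component, where they are adjacent,
    and asymmetry orients that edge the right way. *)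

Lemma set_bij_card_eq {T U : Type} {A : set T} {B : set U} {f : T -> U} :
  set_bij A B f -> (A #= B)%card.
Proof. by move=> /Pbij[g _]; exact: pcard_eq. Qed.

Lemma trivIset_inj {T I : Type} {K : I -> set T} {i j : I} {x : T} :
  trivIset [set: I] K -> K i x -> K j x -> i = j.
Proof. by move=> K_triv Kix Kjx; apply: K_triv => //; exists x. Qed.

Lemma tournament_adjacent {T : Type} {X : binary_structure T} {x y : T} :
  tournament X -> carrier X x -> carrier X y -> x <> y ->
  edge X (x, y) \/ edge X (y, x).
Proof. by move=> [_ tot] Xx Xy /(tot _ _ Xx Xy)[[]|[]]; [left|right]. Qed.

Lemma tournament_asymmetric {T : Type} {X : binary_structure T} {x y : T} :
  tournament X -> edge X (x, y) -> ~ edge X (y, x).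
Proof.
move=> [irr tot] Xxy Xyx.
have [Xx Xy] := edge_sub Xxy.
have xy : x <> y by move=> xy; rewrite xy in Xxy; exact: irr Xxy.
by case: (tot _ _ Xx Xy xy) => -[].
Qed.

Lemma linear_order_tournament {T : Type} {X : binary_structure T} :
  linear_order X -> tournament X.
Proof.
move=> [[irr trans] tot]; split=> // x y Xx Xy xy.
by case: (tot x y Xx Xy xy) => Xe; [left|right]; split=> // Xe';
   exact: irr (trans _ _ _ Xe Xe').
Qed.

Section Union.
Context {T I : Type} {X : I -> binary_structure T}.
Context (X_disjoint : trivIset [set: I] (fun i => carrier (X i))).

(** Meant for edges between images under an endomorphism: there [i] and [j] are values of the
    induced map on indices, and a single edge forces these values to coincide. *)
Lemma union_edge_same {i j k : I} {x y : T} :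
  edge (X k) (x, y) -> carrier (X i) x -> carrier (X j) y -> i = k /\ j = k.
Proof.
move=> /edge_sub[/= Xkx Xky] Xix Xjy.
by split; [exact: trivIset_inj X_disjoint Xix Xkx
          |exact: trivIset_inj X_disjoint Xjy Xky].
Qed.

Lemma union_irreflexive :
  (forall i, irreflexive_structure (X i)) ->
  irreflexive_structure (union_structure X).
Proof. by move=> irr x [i _]; exact: irr. Qed.

Lemma union_transitive :
  (forall i, transitive_structure (X i)) ->
  transitive_structure (union_structure X).
Proof.
move=> trans x y z [i _ Xxy] [j _ Xyz]; exists i => //.
have [/= _ Xiy] := edge_sub Xxy; have [/= Xjy Xjz] := edge_sub Xyz.
by rewrite -(trivIset_inj X_disjoint Xiy Xjy) in Xyz; exact: trans Xxy Xyz.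
Qed.

(** Each edge lies inside one component, so by disjointness membership in [X i] passes along it in
    both directions, hence along any undirected path. A path from [X i] to [X j] would thus put its
    endpoint in both. *)
Lemma union_disconnected :
  (forall i, carrier (X i) !=set0) -> (exists i j : I, i <> j) ->
  disconnected_structure (union_structure X).
Proof.
move=> X_nonempty [i [j ij]] conn.
have [x Xix] := X_nonempty i; have [y Xjy] := X_nonempty j.
have invariant a b :
    clos_refl_sym_trans T (fun a b => edge (union_structure X) (a, b)) a b ->
    carrier (X i) a <-> carrier (X i) b.
  elim=> {a b} [a b [k _ Xab]|a|a b _ IH|a b c _ IH1 _ IH2] //; last 2 first.
  - by split=> /IH.
  - by rewrite IH1.
  have [/= Xka Xkb] := edge_sub Xab.
  split=> [Xia|Xib].
    by rewrite (trivIset_inj X_disjoint Xia Xka).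
  by rewrite (trivIset_inj X_disjoint Xib Xkb).
apply: ij; apply: (trivIset_inj X_disjoint _ Xjy).
by apply/(invariant _ _ (conn x y _ _)) => //; [exists i|exists j].
Qed.

(** A base point [x0] of [X i] fixes the target component: any other point of [X i] is adjacent to
    [x0], and the image of that edge lies in one component, which by disjointness is the one
    containing [f x0]. *)
Lemma tournament_union_endomorphism_components {f : T -> T} :
  (forall i, carrier (X i) !=set0) -> (forall i, tournament (X i)) ->
  bijective_endomorphism (union_structure X) f ->
  exists g : I -> I, forall i x, carrier (X i) x -> carrier (X (g i)) (f x).
Proof.
move=> X_nonempty X_tournament [[f_fun _ _] f_homo].
suff /choice[g gP] : forall i, exists j,
    forall x, carrier (X i) x -> carrier (X j) (f x) by exists g.
move=> i; have [x0 Xx0] := X_nonempty i.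
have [j _ Xjf0] : carrier (union_structure X) (f x0) by apply: f_fun; exists i.
exists j => x Xx.
have [<-//|x0x] := pselect (x0 = x).
have edge_f a b : edge (X i) (a, b) -> exists k, edge (X k) (f a, f b).
  move=> Xab; have [|k _ Xk] := f_homo a b; last by exists k.
  by exists i.
case: (tournament_adjacent (X_tournament i) Xx0 Xx x0x) =>
    /edge_f[k /edge_sub[/= Xk Xk']].
  by rewrite (trivIset_inj X_disjoint Xjf0 Xk).
by rewrite (trivIset_inj X_disjoint Xjf0 Xk').
Qed.

Lemma reversible_cardinals_components_inj {f : T -> T} {g : I -> I} :
  (forall i, carrier (X i) !=set0) ->
  reversible_cardinals (fun i => carrier (X i)) ->
  set_bij (\bigcup_i carrier (X i)) (\bigcup_i carrier (X i)) f ->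
  (forall i x, carrier (X i) x -> carrier (X (g i)) (f x)) ->
  injective g.
Proof.
move=> X_nonempty X_reversible [f_fun f_inj f_surj] gP.
suff: set_inj [set: I] g by move=> g_inj i j; apply: g_inj; rewrite inE.
(* A non-injective [g] would be a surjection of the forbidden kind; what remains is its surjectivity
   and the cardinal equation at [j]. *)
apply: contrapT => g_ninj; apply: X_reversible; exists g; split=> // j.
  move=> _; have [y Xjy] := X_nonempty j.
  have [|x [i _ Xix] fxy] := f_surj y; first by exists j.
  exists i => //; apply: (trivIset_inj X_disjoint _ Xjy).
  by rewrite -fxy; exact: gP.
apply/card_esym; apply: (@set_bij_card_eq _ _ _ _ (fun z => f z.2)).
split=> [[i x] [/= <- Xix]|[i x] [i' x']|y Xjy]; first exact: gP.
  rewrite !inE => -[/= _ Xix] [/= _ Xix'] fxx'.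
  have xx' : x = x' by apply: f_inj => //; rewrite inE; [exists i|exists i'].
  by rewrite -xx' in Xix' *; rewrite (trivIset_inj X_disjoint Xix Xix').
have [|x [i _ Xix] fxy] := f_surj y; first by exists j.
exists (i, x) => //; split=> //=; apply: (trivIset_inj X_disjoint _ Xjy).
by rewrite -fxy; exact: gP.
Qed.

Lemma tournament_union_reversible :
  (forall i, carrier (X i) !=set0) ->
  reversible_cardinals (fun i => carrier (X i)) ->
  (forall i, tournament (X i)) -> reversible (union_structure X).
Proof.
move=> X_nonempty X_reversible X_tournament f f_endo.
have [g gP] := tournament_union_endomorphism_components
  X_nonempty X_tournament f_endo.
case: (f_endo) => f_bij f_homo.
have g_inj := reversible_cardinals_components_inj
  X_nonempty X_reversible f_bij gP.
split=> // x y [i _ Xix] [j _ Xjy]; split=> [/f_homo//|[k _ Xkf]].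
have [gik gjk] := union_edge_same Xkf (gP _ _ Xix) (gP _ _ Xjy).
have ij : i = j by apply: g_inj; rewrite gik.
subst j k.
(* Otherwise the edge from [f x] to [f y] would be a loop. *)
have xy : x <> y.
  by move=> xy; rewrite xy in Xkf; exact: (X_tournament (g i)).1 Xkf.
case: (tournament_adjacent (X_tournament i) Xix Xjy xy) => [|Xyx].
  by exists i.
(* If the edge ran from [y] to [x], its image would reverse the given edge [Xkf] inside the same
   tournament [X (g i)]. *)
have [|k _ Xkyx] := f_homo y x; first by exists i.
have [_ gik] := union_edge_same Xkyx (gP _ _ Xjy) (gP _ _ Xix); subst k.
by case: (tournament_asymmetric (X_tournament (g i)) Xkf).
Qed.

End Union.

Theorem theorem3p4 (T I : Type) (X : I -> binary_structure T)
    (I_nonempty : [set: I] !=set0)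
    (X_nonempty : forall i, carrier (X i) !=set0)
    (X_disjoint : trivIset [set: I] (fun i => carrier (X i)))
    (X_reversible : reversible_cardinals (fun i => carrier (X i))) :
  ((forall i, tournament (X i)) -> reversible (union_structure X)) /\
  ((forall i, linear_order (X i)) ->
     [/\ reversible (union_structure X),
         partial_order (union_structure X)
       & (exists i j : I, i <> j) ->
           disconnected_structure (union_structure X)]).
Proof.
have union_reversible :=
  tournament_union_reversible X_disjoint X_nonempty X_reversible.
split=> // X_linear; split.
- by apply: union_reversible => i; exact: linear_order_tournament.
- split; first by apply: union_irreflexive => i; exact: (X_linear i).1.1.
  by apply: (union_transitive X_disjoint) => i; exact: (X_linear i).1.2.
- exact: union_disconnected X_disjoint X_nonempty.
Qed.
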